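(* There exist a balanced measure $\mu$ on $\mathbb{R}$ and a weight $w\in A_2(\mu)$ such that the dyadic Hilbert transform $\mathrm{Sh}$ is unbounded on $L^2(w\,d\mu)$.
   Context: $\mathscr{D}$ is the standard dyadic system of half-open intervals $2^{-k}[j,j+1)$, $j,k\in\mathbb{Z}$. For $I\in\mathscr{D}$, $I_-$ and $I_+$ are its left and right dyadic children and $\widehat{I}$ its dyadic parent. $\mu$ is a Borel measure on $\mathbb{R}$ with $0<\mu(I)<\infty$ for all $I\in\mathscr{D}$. Pairings and averages are with respect to $\mu$: $\langle f,g\rangle=\int fg\,d\mu$, $\langle f\rangle_I=\mu(I)^{-1}\int_I f\,d\mu$. Set $m(I)=\mu(I_-)\mu(I_+)/\mu(I)$. The measure $\mu$ is balanced if it has no atoms and there is $c\ge1$ with $c^{-1}m(\widehat{I})\le m(I)\le c\,m(\widehat{I})$ for all $I\in\mathscr{D}$. The Haar function of $I$ is $h_I=\sqrt{m(I)}\left(\frac{1_{I_-}}{\mu(I_-)}-\frac{1_{I_+}}{\mu(I_+)}\right)$. The dyadic Hilbert transform (with respect to $\mu$) is $\mathrm{Sh}f=\sum_{I\in\mathscr{D}}\langle f,h_I\rangle\,(h_{I_-}-h_{I_+})$, $f\in L^2(\mu)$; it is bounded on $L^2(w\,d\mu)$ if $\|\mathrm{Sh}f\|_{L^2(w\,d\mu)}\le C\|f\|_{L^2(w\,d\mu)}$ for all $f\in L^2(\mu)\cap L^2(w\,d\mu)$ with $C$ independent of $f$, and unbounded otherwise. A weight is a $\mu$-a.e. positive function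 $w\in L^1_{\mathrm{loc}}(\mu)$. $A_2(\mu)$ is the (dyadic) class of weights with $\sup_{I\in\mathscr{D}}\langle w\rangle_I\langle w^{-1}\rangle_I<\infty$. *)

(* Defs.v *)
From HB Require Import structures.
From mathcomp Require Import all_boot all_order all_algebra finmap.
From mathcomp Require Import all_classical all_reals all_analysis.
From mathcomp.analysis.showcase Require Export summability.

Set Implicit Arguments.
Unset Strict Implicit.
Unset Printing Implicit Defensive.
Import Order.TTheory GRing.Theory Num.Theory.
Import numFieldNormedType.Exports.

Local Open Scope classical_set_scope.
Local Open Scope ring_scope.

(* The pair (k, j) stands for the dyadic interval 2^-k [j, j + 1[.
   This indexing of the dyadic system by int * int is bijective. *)
Notation dyadic := (int * int)%type.

Definition dyadic_set (R : realType) (I : dyadic) : set R :=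
  [set` `[2 ^ (- I.1) * I.2%:~R, 2 ^ (- I.1) * (I.2 + 1)%:~R[].
Arguments dyadic_set R I : clear implicits.

Definition left_child (I : dyadic) : dyadic := (I.1 + 1, 2 * I.2).

Definition right_child (I : dyadic) : dyadic := (I.1 + 1, 2 * I.2 + 1).

(* divz by 2 rounds towards -oo, so that (k, 2j) and (k, 2j + 1) both have
   parent (k - 1, j) for every integer j. *)
Definition parent (I : dyadic) : dyadic := (I.1 - 1, (I.2 %/ 2)%Z).

Section balanced_measures.
Context {R : realType}.

(* measurableTypeR R is R equipped with its Borel sigma-algebra. *)
Variable mu : {measure set (measurableTypeR R) -> \bar R}.

Definition is_atom (A : set R) : Prop :=
  [/\ measurable (A : set (measurableTypeR R)), (0 < mu A)%E &
      forall B : set R, measurable (B : set (measurableTypeR R)) ->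
        B `<=` A -> mu B = 0%E \/ mu B = mu A].

(* "fine" loses nothing here: mu is finite on dyadic intervals as soon as
   it is balanced. *)
Definition dmass (I : dyadic) : R := fine (mu (dyadic_set R I)).

Definition mI (I : dyadic) : R :=
  dmass (left_child I) * dmass (right_child I) / dmass I.

Definition balanced : Prop :=
  [/\ forall I, (0 < mu (dyadic_set R I) < +oo)%E,
      forall A, ~ is_atom A &
      exists2 c : R, 1 <= c &
        forall I, c^-1 * mI (parent I) <= mI I <= c * mI (parent I)].

Definition haar (I : dyadic) (x : R) : R :=
  Num.sqrt (mI I) * (\1_(dyadic_set R (left_child I)) x / dmass (left_child I)
                   - \1_(dyadic_set R (right_child I)) x / dmass (right_child I)).

Definition pairing (f g : R -> R) : R := \int[mu]_x (f x * g x).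

Definition Sh_partial (f : R -> R) (F : {fset dyadic}) (x : R) : R :=
  \sum_(I <- F) pairing f (haar I) *
                (haar (left_child I) x - haar (right_child I) x).

(* g is a representative of Sh f: the series over all dyadic intervals
   converges to g unconditionally (along the net of finite sets of dyadic
   intervals) in L^2(mu). *)
Definition is_Sh (f g : R -> R) : Prop :=
  g \in Lfun mu 2%:E /\
  'N[mu]_2%:E[(fun x => (Sh_partial f F x - g x)%R%:E)]%E @[F --> totally]
    --> (0 : \bar R)%E.

(* An average is extended-real valued, since that of w^-1 may be infinite. *)
Definition average (f : R -> R) (I : dyadic) : \bar R :=
  ((dmass I)^-1%:E * \int[mu]_(x in dyadic_set R I) (f x)%:E)%E.

Definition weight (w : R -> R) : Prop :=
  [/\ measurable_fun [set: measurableTypeR R] w,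
      {ae mu, forall x, 0 < w x} &
      forall K : set R, compact K -> mu.-integrable K (EFin \o w)].

Definition A2 (w : R -> R) : Prop :=
  weight w /\
  (ereal_sup (range (fun I => average w I * average (fun x => (w x)^-1)%R I))
     < +oo)%E.

Definition weighted_norm (w f : R -> R) : \bar R :=
  ((\int[mu]_x (`|f x| ^+ 2 * w x)%:E) `^ 2^-1)%E.

Definition Sh_bounded (w : R -> R) : Prop :=
  exists C : R, forall f g : R -> R,
    f \in Lfun mu 2%:E -> (weighted_norm w f < +oo)%E -> is_Sh f g ->
    (weighted_norm w g <= C%:E * weighted_norm w f)%E.

End balanced_measures.

(* Main.v *)
Require Import Defs.
From HB Require Import structures.
From mathcomp Require Import all_boot all_order all_algebra.
From mathcomp Require Import all_classical all_reals all_analysis.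
From mathcomp Require Import measurable_realfun finmap ring lra zify.

(** Let [mu] have density [1] on ]-oo, 1[ and [2 ^- n] on
    A_n = [2 ^ n, 2 ^ n.+1[, so that A_n has mass [1] and J_n = [0, 2 ^ n[ has
    mass [n.+1]. The children J_n and A_n of J_(n+1) have very different masses,
    but m(J_(n+1)) = (n+1)/(n+2) stays of order 1, and on intervals where the
    density is constant m is halved at each generation: [mu] is balanced.
    Let [w] be [1 + n / 2] on A_(n-1) when [n > 1] is a power of 2, and [1]
    elsewhere. The averages of [w] over J_n are at most 2 and [w >= 1], hence
    [w] is in A_2. For such an [n], the square of h = h_(J_(n+1)) is at most
    [1 / (n+1) ^ 2] on J_n and at most 1 on A_n, where [w = 1], so the weighted
    norm of h is bounded; but Sh h = h_(J_n) - h_(A_n) has square at least [1/2]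
    on A_(n-1), a set of mass 1 where [w = 1 + n / 2]. *)

Set Implicit Arguments.
Unset Strict Implicit.
Unset Printing Implicit Defensive.
Import Order.TTheory GRing.Theory Num.Theory.
Import numFieldNormedType.Exports.

Local Open Scope classical_set_scope.
Local Open Scope ring_scope.

(** * Dyadic intervals as level sets of integer parts *)

Section dyadic_intervals.
Context {R : realType}.
Implicit Types (I J : dyadic) (x y z : R) (k l : int).

(** Turns membership into an equation between integers, so that nesting and disjointness of dyadic
    intervals reduce to integer division by 2. *)
Lemma dyadic_setP I x :
  dyadic_set R I x <-> Num.floor (2 ^ I.1 * x) = I.2.
Proof.
have p0 : 0 < 2 ^ I.1 :> R by rewrite exprz_gt0.
rewrite /dyadic_set /= in_itv /= -!invr_expz ler_pdivrMl// ltr_pdivlMl//.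
by split=> [/floor_def//|<-]; rewrite floor_itv.
Qed.

Lemma floor_half z : Num.floor z = (Num.floor (2 * z) %/ 2)%Z.
Proof.
apply: floor_def; set n := Num.floor (2 * z).
have /andP[n1 n2] : n%:~R <= 2 * z < (n + 1)%:~R by exact: floor_itv.
have [q1 q2] : (2 * (n %/ 2)%Z <= n)%R /\ (n + 1 <= 2 * ((n %/ 2)%Z + 1))%R by lia.
move: q1 q2; rewrite -!(ler_int R) !intrM !intrD; move: n1 n2; rewrite intrD; lra.
Qed.

Lemma floor_scale_half k x :
  Num.floor (2 ^ k * x) = (Num.floor (2 ^ (k + 1) * x) %/ 2)%Z.
Proof. by rewrite exprzDr ?unitfE// expr1z mulrAC [_ * 2]mulrC -floor_half. Qed.

(** This is nestedness: points sharing an interval of generation [l] share one of every coarser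
    generation [k], by halving [l - k] times. *)
Lemma floor_scale_le k l x y : k <= l ->
  Num.floor (2 ^ l * x) = Num.floor (2 ^ l * y) ->
  Num.floor (2 ^ k * x) = Num.floor (2 ^ k * y).
Proof.
move=> kl; have -> : l = k + `|l - k|%N%:Z by rewrite gez0_abs ?subr_ge0//; lia.
elim: `|l - k|%N => [|d IH]; first by rewrite addr0.
rewrite intS (addrC 1) addrA => e; apply: IH.
by rewrite [LHS]floor_scale_half [RHS]floor_scale_half e.
Qed.

Lemma dyadic_set_children I :
  dyadic_set R I = dyadic_set R (left_child I) `|` dyadic_set R (right_child I).
Proof.
apply/seteqP; split => x /=; rewrite !dyadic_setP /= (floor_scale_half I.1 x);
  by move: (Num.floor _) => n; lia.
Qed.

Lemma dyadic_set_childrenI I :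
  dyadic_set R (left_child I) `&` dyadic_set R (right_child I) = set0.
Proof. by apply/seteqP; split => x //= []; rewrite !dyadic_setP /= => ->; lia. Qed.

Lemma dyadic_set_parent I : dyadic_set R I `<=` dyadic_set R (parent I).
Proof.
move=> x; rewrite !dyadic_setP /= => <-; rewrite [LHS]floor_scale_half.
by rewrite subrK.
Qed.

Lemma measurable_dyadic I : measurable (dyadic_set R I : set (measurableTypeR R)).
Proof. exact: measurable_itv. Qed.

End dyadic_intervals.

(** * Orthonormality of the Haar functions and the action of Sh on them *)

Section haar_functions.
Context {R : realType}.
Variable mu : {measure set (measurableTypeR R) -> \bar R}.
Hypothesis mu_gt0 : forall I, (0 < mu (dyadic_set R I) < +oo)%E.
Implicit Types (I J : dyadic) (x y : R).

Lemma dmassK I : (dmass mu I)%:E = mu (dyadic_set R I).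
Proof. by rewrite /dmass fineK// ge0_fin_numE//; case/andP: (mu_gt0 I). Qed.

Lemma dmass_gt0 I : 0 < dmass mu I.
Proof. by rewrite -lte_fin dmassK; case/andP: (mu_gt0 I). Qed.

Lemma dmass_children I :
  dmass mu I = dmass mu (left_child I) + dmass mu (right_child I).
Proof.
apply: EFin_inj; rewrite EFinD !dmassK dyadic_set_children measureU//.
- exact: measurable_dyadic.
- exact: measurable_dyadic.
- exact: dyadic_set_childrenI.
Qed.

Lemma mI_gt0 I : 0 < mI mu I.
Proof. by rewrite divr_gt0 ?mulr_gt0 ?dmass_gt0. Qed.

Lemma indic_Lfun2 I : (\1_(dyadic_set R I) : R -> R) \in Lfun mu 2%:E.
Proof.
apply/andP; split; apply: mem_set.
  by apply: measurable_indic; exact: measurable_dyadic.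
rewrite /finite_norm unlock /Lnorm /=; apply: poweR_lty.
rewrite (_ : \int[mu]_x _ = \int[mu]_x (\1_(dyadic_set R I) x)%:E)%E.
  rewrite integral_indic ?setIT//; last exact: measurable_dyadic.
  by case/andP: (mu_gt0 I).
apply: eq_integral => x _; rewrite /= indicE.
by case: (_ \in _); rewrite ?normr1 ?normr0 ?powR1 ?powR0.
Qed.

Let one_le2 : (1 <= 2%:E :> \bar R)%E. Proof. by rewrite lee_fin ler1n. Qed.

Lemma Lfun2_linear (a b : R) (f g : R -> R) :
  f \in Lfun mu 2%:E -> g \in Lfun mu 2%:E ->
  (fun x => a * f x + b * g x) \in Lfun mu 2%:E.
Proof.
move=> f2 g2; have [L0 LD] := Lfun_submod_closed mu one_le2.
by have := LD a f _ f2 (LD b g 0 g2 L0); rewrite addr0.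
Qed.

Lemma haar_Lfun2 I : haar mu I \in Lfun mu 2%:E.
Proof.
rewrite (_ : haar mu I = fun x =>
    Num.sqrt (mI mu I) / dmass mu (left_child I) * \1_(dyadic_set R (left_child I)) x
    + - (Num.sqrt (mI mu I) / dmass mu (right_child I)) *
      \1_(dyadic_set R (right_child I)) x).
  by apply: Lfun2_linear; exact: indic_Lfun2.
by apply/funext => x; rewrite /haar; ring.
Qed.

Lemma haar_left I x : dyadic_set R (left_child I) x ->
  haar mu I x = Num.sqrt (mI mu I) / dmass mu (left_child I).
Proof.
move=> xl; rewrite /haar !indicE (mem_set xl) memNset; first by rewrite mul0r subr0 mul1r.
by move=> xr; rewrite -[False]/(set0 x) -(dyadic_set_childrenI I).
Qed.

Lemma haar_right I x : dyadic_set R (right_child I) x ->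
  haar mu I x = - (Num.sqrt (mI mu I) / dmass mu (right_child I)).
Proof.
move=> xr; rewrite /haar !indicE (mem_set xr) memNset; first by rewrite mul0r sub0r mul1r mulrN.
by move=> xl; rewrite -[False]/(set0 x) -(dyadic_set_childrenI I).
Qed.

Lemma haar_out I x : ~ dyadic_set R I x -> haar mu I x = 0.
Proof.
rewrite dyadic_set_children => /not_orP[xl xr].
by rewrite /haar !indicE !memNset// !mul0r subr0 mulr0.
Qed.

Lemma Rintegral_dyadic_cst (f : R -> R) I c :
  (forall x, dyadic_set R I x -> f x = c) ->
  \int[mu]_(x in dyadic_set R I) f x = c * dmass mu I.
Proof.
move=> fc; rewrite (@eq_Rintegral _ _ _ _ _ (cst c)) ?Rintegral_cst//.
- exact: measurable_dyadic.
- by move=> x /set_mem /fc.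
Qed.

Lemma Rintegral_children (f : R -> R) I :
  mu.-integrable (dyadic_set R I) (EFin \o f) ->
  \int[mu]_(x in dyadic_set R I) f x =
  \int[mu]_(x in dyadic_set R (left_child I)) f x +
  \int[mu]_(x in dyadic_set R (right_child I)) f x.
Proof.
rewrite dyadic_set_children => fi; rewrite Rintegral_setU//.
- exact: measurable_dyadic.
- exact: measurable_dyadic.
- by apply/disj_set2P; exact: dyadic_set_childrenI.
Qed.

Lemma integrable_haarM I J (D : set (measurableTypeR R)) : measurable D ->
  mu.-integrable D (fun x => (haar mu I x * haar mu J x)%:E).
Proof.
move=> mD; apply: (integrableS measurableT) => //.
by apply/Lfun1_integrable; apply: Lfun2_mul_Lfun1; exact: haar_Lfun2.
Qed.

Lemma pairing_haar_support I J :
  pairing mu (haar mu I) (haar mu J) =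
  \int[mu]_(x in dyadic_set R J) (haar mu I x * haar mu J x).
Proof.
rewrite /pairing [RHS]Rintegral_mkcond; apply: eq_Rintegral => x _.
rewrite patchE; case: ifPn => // /negP xJ.
by rewrite (@haar_out J) ?mulr0// => ?; apply: xJ; exact: mem_set.
Qed.

(** Two points of a strictly finer [J] share an interval of generation [I.1 + 1], so they lie in the
    same child of [I] or in none; another interval of the same generation is disjoint from [I]. *)
Lemma haar_cst I J : I.1 <= J.1 -> I != J ->
  exists c, forall x, dyadic_set R J x -> haar mu I x = c.
Proof.
move=> IJ nIJ; suff H x y : dyadic_set R J x -> dyadic_set R J y ->
    haar mu I x = haar mu I y.
  have [[y yJ]|noJ] := pselect (exists y, dyadic_set R J y).
    by exists (haar mu I y) => x xJ; exact: H.
  by exists 0 => x xJ; case: noJ; exists x.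
move=> xJ yJ; have [{}IJ|JI] := ltP I.1 J.1.
  have e : Num.floor (2 ^ (I.1 + 1) * x) = Num.floor (2 ^ (I.1 + 1) * y).
    apply: (@floor_scale_le _ _ J.1); first by rewrite -lezD1 in IJ.
    by move: xJ yJ; rewrite !dyadic_setP => -> ->.
  have inE K : K.1 = I.1 + 1 -> (x \in dyadic_set R K) = (y \in dyadic_set R K).
    by move=> K1; apply/idP/idP => /set_mem h; apply/mem_set; move: h;
       rewrite !dyadic_setP K1 e.
  by rewrite /haar !indicE !inE.
have e1 : I.1 = J.1 by apply/eqP; rewrite eq_le IJ.
have out z : dyadic_set R J z -> ~ dyadic_set R I z.
  rewrite !dyadic_setP e1 => -> e2; move: nIJ.
  by rewrite [I]surjective_pairing [J]surjective_pairing e1 e2 eqxx.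
by rewrite !haar_out//; exact: out.
Qed.

(** By symmetry [I] may be taken no finer than [J]. Then [haar mu I] is constant on [J], and
    [haar mu J] has mean zero: its integrals over the two children of [J] are opposite. *)
Lemma pairing_haar_neq I J : I != J -> pairing mu (haar mu I) (haar mu J) = 0.
Proof.
wlog IJ : I J / I.1 <= J.1.
  move=> H nIJ; have [IJ|/ltW IJ] := leP I.1 J.1; first exact: H.
  rewrite -[RHS](H J I)//; last by rewrite eq_sym.
  by apply: eq_Rintegral => x _; rewrite mulrC.
move=> /(haar_cst IJ)[c cE]; rewrite pairing_haar_support Rintegral_children.
  rewrite (@Rintegral_dyadic_cst _ _ (c * (Num.sqrt (mI mu J) / dmass mu (left_child J)))).
    rewrite (@Rintegral_dyadic_cst _ _ (c * - (Num.sqrt (mI mu J) / dmass mu (right_child J)))).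
      by field; rewrite !gt_eqF ?dmass_gt0.
    by move=> x xJ; rewrite (haar_right xJ) cE// dyadic_set_children; right.
  by move=> x xJ; rewrite (haar_left xJ) cE// dyadic_set_children; left.
by apply: integrable_haarM; exact: measurable_dyadic.
Qed.

(** The factor [mI] is the right normalisation because m(I) (1 / mu(I_-) + 1 / mu(I_+)) = 1. *)
Lemma pairing_haar_eq I : pairing mu (haar mu I) (haar mu I) = 1.
Proof.
rewrite pairing_haar_support Rintegral_children; last first.
  by apply: integrable_haarM; exact: measurable_dyadic.
have lK : dmass mu (left_child I) != 0 by rewrite gt_eqF ?dmass_gt0.
have rK : dmass mu (right_child I) != 0 by rewrite gt_eqF ?dmass_gt0.
have IK : dmass mu I != 0 by rewrite gt_eqF ?dmass_gt0.
have s2 : Num.sqrt (mI mu I) ^+ 2 = mI mu I by rewrite sqr_sqrtr// ltW// mI_gt0.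
rewrite (@Rintegral_dyadic_cst _ _ (mI mu I / dmass mu (left_child I) ^+ 2)).
  rewrite (@Rintegral_dyadic_cst _ _ (mI mu I / dmass mu (right_child I) ^+ 2)).
    by move: IK; rewrite /mI dmass_children => IK; field; rewrite rK IK.
  by move=> x xI; rewrite (haar_right xI) -[X in _ = X / _]s2; field.
by move=> x xI; rewrite (haar_left xI) -[X in _ = X / _]s2; field.
Qed.

(** By orthonormality every partial sum over a finite set containing [I] is exactly this difference,
    so the net of distances is eventually 0. *)
Lemma is_Sh_haar I :
  is_Sh mu (haar mu I) (haar mu (left_child I) \- haar mu (right_child I)).
Proof.
split.
  rewrite (_ : _ \- _ = fun x => 1 * haar mu (left_child I) x
    + -1 * haar mu (right_child I) x).
    by apply: Lfun2_linear; exact: haar_Lfun2.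
  by apply/funext => x /=; ring.
apply: cvg_near_cst; first exact: totally_filter.
 exists [fset I]%fset => // F /= IF.
rewrite -[RHS](@Lnorm0 _ _ _ mu 2%:E)//.
apply: eq_Lnorm => x /=; congr EFin.
have {}IF : I \in F by apply: (fsubsetP IF); rewrite inE.
rewrite /Sh_partial (big_fsetD1 I)//= pairing_haar_eq mul1r big1_fset ?addr0 ?subrr//.
by move=> J; rewrite !inE => /andP[JI _] _; rewrite pairing_haar_neq ?mul0r// eq_sym.
Qed.

End haar_functions.

(** * The shells, the measure and its values on dyadic intervals *)

Section shells.
Context {R : realType}.
Implicit Types (I : dyadic) (x y : R) (n e : nat) (h : nat -> R).

(* Index of the shell of [x] among ]-oo, 1[, [1, 2[, [2, 4[, [4, 8[ and so on;
   [truncn] is 0 on negative numbers. *)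
Definition shell x : nat := up_log 2 (Num.truncn x).+1.

Lemma shell_le x e : (shell x <= e)%N = (x < 2 ^+ e).
Proof.
have -> : (x < 2 ^+ e) = (Num.truncn x < 2 ^ e)%N.
  have p : (0 < 2 ^ e)%N by rewrite expn_gt0.
  by rewrite -[in RHS](prednK p) ltnS truncn_le_nat prednK// natrX.
apply/idP/idP => [se|]; last exact: up_log_min.
by rewrite (leq_trans (@up_logP 2 _ isT))// leq_exp2l.
Qed.

(** The level sets of [shell] are Borel, being rays or differences of two rays, and every preimage
    is a countable union of them. *)
Lemma measurable_comp_shell h (D : set (measurableTypeR R)) :
  measurable_fun D (h \o shell).
Proof.
apply: measurable_funS measurableT (@subsetT _ _) _ => _ Y mY; rewrite setTI.
have mle e : measurable ([set x | (shell x <= e)%N] : set (measurableTypeR R)).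
  rewrite (_ : [set x | _] = `]-oo, 2 ^+ e[%classic); first exact: measurable_itv.
  by apply/seteqP; split => x; rewrite /= shell_le in_itv.
have meq e : measurable ([set x | shell x = e] : set (measurableTypeR R)).
  case: e => [|e].
    rewrite (_ : [set x | _] = [set x | (shell x <= 0)%N])//.
    by apply/seteqP; split => x /=; rewrite leqn0 => /eqP.
  rewrite (_ : [set x | _] = [set x | (shell x <= e.+1)%N] `\` [set x | (shell x <= e)%N]).
    exact: measurableD.
  by apply/seteqP; split => x /=; lia.
rewrite (_ : _ @^-1` Y = \bigcup_(e in h @^-1` Y) [set x | shell x = e]).
  by apply: bigcup_measurable => e _; exact: meq.
apply/seteqP; split => [x Yx|x [e Ye /= xe]]; last by rewrite /= xe.
by exists (shell x).
Qed.

(** For positive [n] this is the inverse of the length of the shell [2 ^ n.-1, 2 ^ n[. At 0 the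
    predecessor truncates, which gives density 1 on ]-oo, 1[. *)
Definition shell_density n : R := (2 ^+ n.-1)^-1.

Lemma shell_density_gt0 n : 0 < shell_density n.
Proof. by rewrite invr_gt0 exprn_gt0. Qed.

Lemma shell_density_le1 n : shell_density n <= 1.
Proof. by rewrite invf_le1 ?exprn_gt0// exprn_ege1// ler1n. Qed.

Definition shell_measure (A : set (measurableTypeR R)) : \bar R :=
  (\int[lebesgue_measure]_(x in A) (shell_density (shell x))%:E)%E.

Let shell_measure0 : shell_measure set0 = 0%E.
Proof. exact: integral_set0. Qed.

Let shell_measure_ge0 A : (0 <= shell_measure A)%E.
Proof. by apply: integral_ge0 => x _; rewrite lee_fin ltW ?shell_density_gt0. Qed.

Let shell_measure_additive : semi_sigma_additive shell_measure.
Proof.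
move=> /= A mA tA mUA.
rewrite /shell_measure/= ge0_integral_bigcup//=; last 2 first.
- by apply/measurable_EFinP; exact: measurable_comp_shell.
- by move=> x _; rewrite lee_fin ltW ?shell_density_gt0.
by apply: is_cvg_ereal_nneg_natsum_cond => n _ _; exact: shell_measure_ge0.
Qed.

HB.instance Definition _ := isMeasure.Build _ _ _
  shell_measure shell_measure0 shell_measure_ge0 shell_measure_additive.

Local Notation mu := (shell_measure : {measure set (measurableTypeR R) -> \bar R}).

(* The flat intervals are those contained in a single shell; the other ones are
   the intervals [0, 2 ^ n[ with [0 < n]. *)
Definition flat I : bool := ~~ ((I.1 < 0) && (I.2 == 0)).

(** Suppose that a power 2 ^ e separates two points of [I]. Scaled by 2 ^ I.1 it is a power of 2
    between two numbers with the same floor, so it is not an integer and its exponent is negative.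
    That floor is then 0 while [I.1 < 0], so [I] is not flat. *)
Lemma shell_flat I x y : flat I -> dyadic_set R I x -> dyadic_set R I y ->
  shell x = shell y.
Proof.
move=> fI.
suff H z t : dyadic_set R I z -> dyadic_set R I t -> (shell z <= shell t)%N.
  by move=> xI yI; apply/eqP; rewrite eqn_leq !H.
rewrite !dyadic_setP => zI tI; rewrite shell_le ltNge; apply/negP.
have : t < 2 ^+ shell t by rewrite -shell_le.
move: (shell t) => e te ez.
have p0 : 0 < 2 ^ I.1 :> R by rewrite exprz_gt0.
have pe : 2 ^ I.1 * 2 ^+ e = 2 ^ (I.1 + e%:Z) :> R by rewrite exprzDr ?unitfE// .
have t1 : 2 ^ I.1 * t < 2 ^ (I.1 + e%:Z) by rewrite -pe ltr_pM2l.
have z1 : 2 ^ (I.1 + e%:Z) <= 2 ^ I.1 * z by rewrite -pe ler_pM2l.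
have [ke|ke] := leP 0 (I.1 + e%:Z).
  have E : 2 ^ (I.1 + e%:Z) = (2 ^+ `|(I.1 + e%:Z)%R|%N)%:~R :> R.
    by rewrite -{1}(gez0_abs ke) rmorphXn.
  move: t1 z1; rewrite E -floor_lt_int -floor_ge_int zI tI.
  by move=> /lt_le_trans h /h; rewrite ltxx.
have k0 : I.1 < 0 by lia.
have : 2 ^ I.1 * t < 1%:~R.
  apply: lt_le_trans t1 _.
  rewrite -[I.1 + _]opprK -invr_expz -(gez0_abs (_ : 0 <= - (I.1 + e%:Z))).
    by rewrite invf_le1 ?exprn_gt0// exprn_ege1// ler1n.
  by rewrite oppr_ge0 ltW.
have : 0%:~R <= 2 ^ I.1 * z by apply: le_trans z1; rewrite ltW// exprz_gt0.
rewrite -floor_lt_int -floor_ge_int zI tI => j0 j1.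
by move: fI; rewrite /flat k0 /= => /eqP; apply; lia.
Qed.

Lemma dyadic_set_base I : dyadic_set R I (2 ^ (- I.1) * I.2%:~R).
Proof.
rewrite dyadic_setP -invr_expz mulrA divff ?mul1r ?intrKfloor//.
by rewrite gt_eqF// exprz_gt0.
Qed.

Lemma shell_measure_flat I x : flat I -> dyadic_set R I x ->
  mu (dyadic_set R I) = (shell_density (shell x) * 2 ^ (- I.1))%:E.
Proof.
move=> fI xI; rewrite /= /shell_measure.
rewrite (eq_integral (cst (shell_density (shell x))%:E)); last first.
  by move=> y /set_mem yI /=; rewrite (shell_flat fI yI xI).
rewrite integral_cst; last exact: measurable_dyadic.
rewrite [X in (_ * X)%E]lebesgue_measure_itv/= lte_fin ltr_pM2l ?exprz_gt0//.
by rewrite ltr_int ltrDl ltr01 -EFinD -mulrBr -intrB addrAC subrr add0r mulr1.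
Qed.

(* These are [2 ^ n, 2 ^ n.+1[, which is the shell of index [n.+1], and
   [0, 2 ^ n[. *)
Definition shell_interval n : dyadic := (- n%:Z, 1).
Definition shell_hull n : dyadic := (- n%:Z, 0).

Lemma left_child_hull n : left_child (shell_hull n.+1) = shell_hull n.
Proof. by rewrite /left_child /shell_hull /=; congr pair; lia. Qed.

Lemma right_child_hull n : right_child (shell_hull n.+1) = shell_interval n.
Proof. by rewrite /right_child /shell_interval /=; congr pair; lia. Qed.

Lemma shell_on_interval n x : dyadic_set R (shell_interval n) x -> shell x = n.+1.
Proof.
rewrite /dyadic_set /= in_itv /= opprK mulr1 => /andP[n1 n2].
apply/eqP; rewrite eqn_leq shell_le ltnNge shell_le -leNgt n1 andbT.
by rewrite exprSr.
Qed.

Lemma shell_measure_interval n : mu (dyadic_set R (shell_interval n)) = 1%E.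
Proof.
have /= b := dyadic_set_base (shell_interval n).
rewrite (shell_measure_flat _ b) ?(shell_on_interval b)//; last by rewrite /flat /= andbF.
by rewrite /shell_density /= opprK mulVf// gt_eqF// exprn_gt0.
Qed.

Lemma shell_on_hull0 x : dyadic_set R (shell_hull 0) x -> shell x = 0%N.
Proof.
rewrite /dyadic_set /= in_itv /= opprK mul1r => /andP[_ x1].
by apply/eqP; rewrite -leqn0 shell_le; move: x1; rewrite expr0z mul1r.
Qed.

Lemma shell_measure_hull0 : mu (dyadic_set R (shell_hull 0)) = 1%E.
Proof.
have /= b := dyadic_set_base (shell_hull 0).
rewrite (shell_measure_flat _ b) ?(shell_on_hull0 b)//.
by rewrite /shell_density /= opprK mulVf// gt_eqF// exprn_gt0.
Qed.

(** J_n splits into J_0 and A_0, ..., A_(n-1), each of mass 1, on which [shell] is 0, 1, ..., n.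
    Masses, averages and weighted norms all become finite sums in this way. *)
Lemma integral_shell_hull h n : (forall k, 0 <= h k) ->
  (\int[mu]_(x in dyadic_set R (shell_hull n)) (h (shell x))%:E
   = (\sum_(k < n.+1) h k)%:E)%E.
Proof.
move=> h0; elim: n => [|n IH].
  rewrite (eq_integral (cst (h 0%N)%:E)); last first.
    by move=> y /set_mem yI /=; rewrite shell_on_hull0.
  rewrite integral_cst; last exact: measurable_dyadic.
  by rewrite big_ord_recl big_ord0 addr0 shell_measure_hull0 mule1.
rewrite dyadic_set_children left_child_hull right_child_hull ge0_integral_setU//=.
- rewrite IH [in RHS]big_ord_recr /= [in RHS]EFinD; congr (_ + _)%E.
  rewrite (eq_integral (cst (h n.+1)%:E)); last first.
    by move=> y /set_mem yI /=; rewrite (shell_on_interval yI).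
  rewrite integral_cst; last exact: measurable_dyadic.
  by rewrite shell_measure_interval mule1.
- exact: measurable_dyadic.
- exact: measurable_dyadic.
- by apply/measurable_EFinP; exact: measurable_comp_shell.
- by move=> x _; rewrite lee_fin.
- apply/disj_set2P; rewrite -left_child_hull -right_child_hull.
  exact: dyadic_set_childrenI.
Qed.

Lemma shell_measure_hull n :
  mu (dyadic_set R (shell_hull n)) = (n.+1%:R)%:E.
Proof.
rewrite -[LHS]mul1e -integral_cst; last exact: measurable_dyadic.
rewrite (@integral_shell_hull (cst 1))// big_const_ord iter_addr_0//.
Qed.

End shells.

(** * The measure is balanced *)

Section shell_balanced.
Context {R : realType}.
Implicit Types (I : dyadic) (x y : R) (n e : nat) (h : nat -> R).
Local Notation mu := (shell_measure : {measure set (measurableTypeR R) -> \bar R}).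

Lemma not_flat I : ~~ flat I -> exists n, I = shell_hull n.+1.
Proof.
case: I => k j; rewrite /flat negbK /= => /andP[k0 /eqP ->].
by exists `|k|%N.-1; rewrite /shell_hull; congr pair; lia.
Qed.

Lemma shell_measure_dyadic_gt0 I : (0 < mu (dyadic_set R I) < +oo)%E.
Proof.
have [fI|/not_flat[n ->]] := boolP (flat I).
  rewrite (shell_measure_flat fI (dyadic_set_base I)) ltry andbT lte_fin.
  by rewrite mulr_gt0 ?exprz_gt0// shell_density_gt0.
by rewrite shell_measure_hull ltry lte_fin ltr0n.
Qed.

Lemma dmass_flat I x : flat I -> dyadic_set R I x ->
  dmass mu I = shell_density (shell x) * 2 ^ (- I.1).
Proof. by move=> fI xI; rewrite /dmass (shell_measure_flat fI xI). Qed.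

Lemma dmass_hull n : dmass mu (shell_hull n) = n.+1%:R.
Proof. by rewrite /dmass shell_measure_hull. Qed.

Lemma dmass_interval n : dmass mu (shell_interval n) = 1.
Proof. by rewrite /dmass shell_measure_interval. Qed.

Lemma mI_hull n : mI mu (shell_hull n.+1) = n.+1%:R / n.+2%:R.
Proof.
by rewrite /mI left_child_hull right_child_hull !dmass_hull dmass_interval mulr1.
Qed.

Lemma flat_parent I : flat (parent I) -> flat I.
Proof. by rewrite /flat /parent /=; lia. Qed.

Lemma flat_interval n : flat (shell_interval n).
Proof. by rewrite /flat /= andbF. Qed.

Lemma dmass_flat_parent I : flat (parent I) -> dmass mu (parent I) = 2 * dmass mu I.
Proof.
move=> fP; have b := @dyadic_set_base R I.
rewrite (dmass_flat fP (dyadic_set_parent b)) (dmass_flat (flat_parent fP) b).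
by rewrite /= opprB exprzDr ?unitfE// expr1z; ring.
Qed.

Lemma parent_left_child I : parent (left_child I) = I.
Proof. by case: I => k j; rewrite /parent /left_child /=; congr pair; lia. Qed.

Lemma parent_right_child I : parent (right_child I) = I.
Proof. by case: I => k j; rewrite /parent /right_child /=; congr pair; lia. Qed.

(** The density is constant on [I], so each child carries half of its mass. *)
Lemma mI_flat I : flat I -> mI mu I = dmass mu I / 4.
Proof.
move=> fI; rewrite /mI.
have := @dmass_flat_parent (left_child I); rewrite parent_left_child => /(_ fI) l.
have := @dmass_flat_parent (right_child I); rewrite parent_right_child => /(_ fI) r.
have := dmass_gt0 shell_measure_dyadic_gt0 (right_child I).
rewrite (_ : dmass mu (left_child I) = dmass mu (right_child I)); last by lra.
by rewrite r => ?; field; rewrite gt_eqF.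
Qed.

Lemma parent_hull I n : parent I = shell_hull n.+1 ->
  I = shell_hull n \/ I = shell_interval n.
Proof.
case: I => k j; rewrite /parent /shell_hull /shell_interval /= => -[kE jE].
have [->|->] : j = 0 \/ j = 1 by lia.
  by left; congr pair; lia.
by right; congr pair; lia.
Qed.

(** Below a flat parent [mI] is exactly halved. Otherwise the parent is some J_(n+1), with [mI] in
    [1/2, 1], and [I] is J_n or A_n, with [mI] in [1/4, 1]; the value 1/4 occurs at J_0 and at every
    A_n. *)
Lemma mI_parent I : 4^-1 * mI mu (parent I) <= mI mu I <= 4 * mI mu (parent I).
Proof.
have [fP|/not_flat[n nE]] := boolP (flat (parent I)).
  rewrite (mI_flat fP) (mI_flat (flat_parent fP)) (dmass_flat_parent fP).
  by have := dmass_gt0 shell_measure_dyadic_gt0 I; lra.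
have q m : 2^-1 <= (m.+1%:R / m.+2%:R : R) <= 1.
  rewrite ler_pdivlMr ?ler_pdivrMr ?ltr0n// mul1r ler_nat leqnSn andbT.
  by rewrite -[m.+2%:R]natr1 -[m.+1%:R]natr1; have : 0 <= m%:R :> R by []; lra.
rewrite nE mI_hull.
have bnd (u v : R) : 2^-1 <= u <= 1 -> 4^-1 <= v <= 1 -> 4^-1 * u <= v <= 4 * u by lra.
apply: bnd; first exact: q.
case: (parent_hull nE) => ->.
  case: n {nE} => [|n].
    by rewrite (mI_flat (isT : flat (shell_hull 0))) dmass_hull; lra.
  by rewrite mI_hull; have := q n; move: (_ / _) => u; lra.
by rewrite (mI_flat (flat_interval n)) dmass_interval; lra.
Qed.

(** The union runs over natural codes of the integers [j], to suit countable unions of negligible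
    sets; a number coding no integer contributes the empty set. *)
Lemma countable_dyadic_cover (A : set R) k :
  A `<=` \bigcup_i (if choice.unpickle i is Some j then A `&` dyadic_set R (k, j) else set0).
Proof.
move=> x Ax; exists (choice.pickle (Num.floor (2 ^ k * x))) => //.
by rewrite choice.pickleK; split=> //; apply/dyadic_setP.
Qed.

Lemma shell_measure_small n j : (mu (dyadic_set R (n%:Z, j)) <= (2 ^- n)%:E)%E.
Proof.
have f : flat (n%:Z, j) by [].
rewrite (shell_measure_flat f (dyadic_set_base _)) lee_fin /= -invr_expz.
by rewrite ler_piMl ?shell_density_le1// invr_ge0 exprn_ge0.
Qed.

Lemma shell_measure_no_atom A : ~ is_atom mu A.
Proof.
move=> [mA A0 atomA].
have small n : (mu A <= (2 ^- n)%:E)%E.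
  have mAI j : measurable (A `&` dyadic_set R (n%:Z, j) : set (measurableTypeR R)).
    by apply: measurableI => //; exact: measurable_dyadic.
  (* The atom has the same measure as one of its intersections with the intervals
     of generation [n], which have measure at most [2 ^- n]. *)
  have [[j Aj]|noj] := pselect (exists j, mu (A `&` dyadic_set R (n%:Z, j)) <> 0%E).
    case: (atomA _ (mAI j) (@subIsetl _ _ _)) => // <-.
    apply: le_trans (shell_measure_small n j).
    exact: (le_measure mu (mem_set (mAI j)) (mem_set (measurable_dyadic _)) (@subIsetr _ _ _)).
  (* If all the intersections are null, then so is [A], their countable union, which an atom cannot
     be. *)
  have mA0 : mu A = 0%E.
    apply: measure_negligible => //.
    apply: (@negligibleS _ _ _ mu _ A (@countable_dyadic_cover A n%:Z)).
    apply: negligible_bigcup => i; case: (choice.unpickle i) => [j|]; last exact: negligible_set0.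
    apply/negligibleP; [exact: mAI|apply: contrapT] => Aj; apply: noj; exists j; exact: Aj.
  by rewrite mA0 ltxx in A0.
have Afin : mu A \is a fin_num.
  by rewrite ge0_fin_numE// (le_lt_trans (small 0%N))// ltry.
have a0 : 0 < fine (mu A) by rewrite -lte_fin fineK.
(* For this [n], 2 ^ n exceeds the inverse of the mass of [A], against the bound 2 ^- n. *)
have := small (Num.bound (fine (mu A))^-1); rewrite -(fineK Afin) lee_fin leNgt.
by rewrite invf_plt ?posrE ?exprn_gt0// upper_nthrootP.
Qed.

Lemma shell_measure_balanced : balanced mu.
Proof.
split; [exact: shell_measure_dyadic_gt0|exact: shell_measure_no_atom|].
by exists 4 => [|I]; [rewrite ler1n|exact: mI_parent].
Qed.

End shell_balanced.

(** * The weight and its A_2 condition *)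

Section shell_weight.
Context {R : realType}.
Implicit Types (I : dyadic) (x y : R) (n e : nat) (h : nat -> R).
Local Notation mu := (shell_measure : {measure set (measurableTypeR R) -> \bar R}).

(** The largest power of 2 that is at most [n], for positive [n]; at 0 the value is 1, since
    [trunc_log 2 0] is 0. *)
Definition floor_pow2 n : nat := 2 ^ trunc_log 2 n.

Lemma leq_floor_pow2 n : (floor_pow2 n <= n.+1)%N.
Proof. by case: n => // n; rewrite (leq_trans (trunc_logP _ _)). Qed.

Lemma floor_pow2_homo m n : (m <= n)%N -> (floor_pow2 m <= floor_pow2 n)%N.
Proof. by move=> mn; rewrite leq_exp2l// leq_trunc_log. Qed.

Lemma floor_pow2_eq n e : (2 ^ e <= n < 2 ^ e.+1)%N -> floor_pow2 n = (2 ^ e)%N.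
Proof. by move=> ne; rewrite /floor_pow2 (@trunc_log_eq 2 e). Qed.

(* Equal to [1 + 2 ^ e] at [n = 2 ^ e.+1] and to [1] at all other [n]; in this form
   the partial sums telescope. *)
Definition shell_value n : R := 1 + (floor_pow2 n)%:R - (floor_pow2 n.-1)%:R.

Lemma shell_value_ge1 n : 1 <= shell_value n.
Proof. by rewrite /shell_value -addrA lerDl subr_ge0 ler_nat floor_pow2_homo// leq_pred. Qed.

Lemma shell_value_gt0 n : 0 < shell_value n.
Proof. exact: lt_le_trans (shell_value_ge1 n). Qed.

Lemma sum_shell_value n : \sum_(k < n.+1) shell_value k = n%:R + (floor_pow2 n)%:R.
Proof.
elim: n => [|n IH].
  by rewrite big_ord1 /shell_value /floor_pow2 /= trunc_log0 expn0; ring.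
by rewrite big_ord_recr /= IH /shell_value /= -natr1; ring.
Qed.

(** The total excess over the weight 1 grows only at powers of 2 and stays below the mass [n.+1] of
    J_n, so the averages over J_n stay bounded although the weight is not. *)
Lemma sum_shell_value_le n : \sum_(k < n.+1) shell_value k <= 2 * n.+1%:R.
Proof.
have : (floor_pow2 n)%:R <= n.+1%:R :> R by rewrite ler_nat leq_floor_pow2.
by rewrite sum_shell_value -natr1; lra.
Qed.

Lemma shell_value_pow2 e : shell_value (2 ^ e.+1) = 1 + 2 ^+ e.
Proof.
rewrite /shell_value (@floor_pow2_eq _ e.+1) ?leqnn ?ltn_exp2l ?ltnSn//.
rewrite (@floor_pow2_eq _ e); last by rewrite !expnS; have := expn_gt0 2 e; lia.
by rewrite !natrX exprS; ring.
Qed.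

(** The weight drops back to 1 right after a large value. Sh moves mass from the light shell A_n to
    the heavy shell A_(n-1) next to it. *)
Lemma shell_value_pow2S e : shell_value (2 ^ e.+1).+1 = 1.
Proof.
rewrite /shell_value /= !(@floor_pow2_eq _ e.+1) ?leqnn ?ltn_exp2l ?ltnSn ?addrK//.
by rewrite !expnS; have := expn_gt0 2 e; lia.
Qed.

Definition shell_weight x : R := shell_value (shell x).

Lemma weight_shell_weight : weight mu shell_weight.
Proof.
split; first exact: measurable_comp_shell.
  by apply: aeW => x; exact: shell_value_gt0.
move=> K cK; have mK := compact_measurable cK.
have [M [Mr /(_ (M + 1))]] := compact_bounded cK.
rewrite ltrDl ltr01 => /(_ isT) KM.
pose n := Num.bound (M + 1).
have M2 : M + 1 < 2 ^+ n by exact: upper_nthrootP.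
(* Two intervals are taken, [0, 2 ^ n[ and [- 2 ^ n, 0[, because no dyadic interval has points on
   both sides of 0. *)
pose U := dyadic_set R (shell_hull n) `|` dyadic_set R (- n%:Z, -1).
have mU : measurable (U : set (measurableTypeR R)).
  by apply: measurableU; exact: measurable_dyadic.
have KU : K `<=` U.
  move=> x Kx; have := KM _ Kx; rewrite /= ler_norml => /andP[x1 x2].
  have [x0|x0] := leP 0 x; [left|right].
    by rewrite /dyadic_set /= in_itv /= opprK mulr0 x0 /= mulr1 (le_lt_trans x2).
  rewrite /dyadic_set /= in_itv /= opprK mulr0 x0 andbT mulrN mulr1.
  by apply: le_trans x1; rewrite lerN2 ltW.
apply: measurable_bounded_integrable => //.
- apply: le_lt_trans (le_measure mu (mem_set mK) (mem_set mU) KU) _.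
  have := measureU2 mu (measurable_dyadic (shell_hull n)) (measurable_dyadic (- n%:Z, -1)).
  move=> /le_lt_trans; apply; rewrite lte_add_pinfty//.
  + by case/andP: (shell_measure_dyadic_gt0 (R := R) (shell_hull n)).
  + by case/andP: (shell_measure_dyadic_gt0 (R := R) (- n%:Z, -1)).
- exact: measurable_comp_shell.
(* Points of [K] have shell index at most [n], and [floor_pow2] is monotone. *)
exists (1 + (floor_pow2 n)%:R); split; first exact: num_real.
move=> B nB x Kx /=; rewrite ger0_norm ?ltW ?shell_value_gt0//.
have sx : (shell x <= n)%N.
  by rewrite shell_le (le_lt_trans _ M2)// (le_trans (ler_norm _))//; exact: KM.
have := floor_pow2_homo sx; rewrite -(ler_nat R) => T.
have : 0 <= (floor_pow2 (shell x).-1)%:R :> R by [].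
rewrite /shell_weight /shell_value; lra.
Qed.

Lemma average_hull_le h c n : (forall k, 0 <= h k) ->
  \sum_(k < n.+1) h k <= c * n.+1%:R ->
  (0 <= average mu (h \o shell) (shell_hull n) <= c%:E)%E.
Proof.
move=> h0 hc; rewrite /average integral_shell_hull// dmass_hull -EFinM !lee_fin.
rewrite ler_pdivrMl ?ltr0n// [_ * c]mulrC hc andbT.
by rewrite mulr_ge0 ?invr_ge0// sumr_ge0.
Qed.

Lemma average_flat h I x : flat I -> dyadic_set R I x ->
  average mu (h \o shell) I = (h (shell x))%:E.
Proof.
move=> fI xI; rewrite /average (eq_integral (cst (h (shell x))%:E)); last first.
  by move=> y /set_mem yI /=; rewrite (shell_flat fI yI xI).
rewrite integral_cst; last exact: measurable_dyadic.
rewrite -(dmassK shell_measure_dyadic_gt0) -!EFinM mulrC mulfK//.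
by rewrite gt_eqF// dmass_gt0//; exact: shell_measure_dyadic_gt0.
Qed.

(** On a flat interval the weight is constant and the product of averages is 1. On a hull the
    averages of [w] and of its inverse are at most 2 and 1. *)
Lemma A2_shell_weight : A2 mu shell_weight.
Proof.
split; first exact: weight_shell_weight.
apply: (@le_lt_trans _ _ 2%:E); last exact: ltry.
apply: ge_ereal_sup => _ [I _ <-].
rewrite (_ : (fun x => (shell_weight x)^-1) = (fun k => (shell_value k)^-1) \o shell)//.
rewrite (_ : shell_weight = shell_value \o shell)//.
have [fI|/not_flat[n ->]] := boolP (flat I).
  rewrite !(average_flat _ fI (dyadic_set_base _)) -EFinM lee_fin.
  by rewrite divff ?ler1n// gt_eqF// shell_value_gt0.
have /andP[a0 a2] : (0 <= average mu (shell_value \o shell) (shell_hull n.+1) <= 2%:E)%E.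
  by apply: average_hull_le => [k|]; [exact/ltW/shell_value_gt0|exact: sum_shell_value_le].
have /andP[b0 b1] : (0 <= average mu ((fun k => (shell_value k)^-1)%R \o shell)
    (shell_hull n.+1) <= 1%:E)%E.
  apply: average_hull_le => [k|]; first by rewrite invr_ge0 ltW ?shell_value_gt0.
  rewrite mul1r (_ : n.+2%:R = \sum_(k < n.+2) 1); last by rewrite sumr_const card_ord.
  by apply: ler_sum => k _; rewrite invf_le1 ?shell_value_gt0 ?shell_value_ge1.
by rewrite -[leRHS]mule1; exact: lee_pmul.
Qed.

End shell_weight.

(** * Unboundedness of Sh on the weighted space *)

Section shell_unbounded.
Context {R : realType}.
Implicit Types (x y : R) (n e : nat) (h : nat -> R).
Local Notation mu := (shell_measure : {measure set (measurableTypeR R) -> \bar R}).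
Local Notation w := (shell_weight (R := R)).
Let mu_gt0 := @shell_measure_dyadic_gt0 R.

Lemma ge0_weighted_integrand (f : R -> R) x : 0 <= `|f x| ^+ 2 * w x.
Proof. by rewrite mulr_ge0 ?exprn_ge0// ltW ?shell_value_gt0. Qed.

Lemma weighted_norm_le (f : R -> R) (a : R) : 0 <= a ->
  (\int[mu]_x (`|f x| ^+ 2 * w x)%:E <= (a ^+ 2)%:E)%E ->
  (weighted_norm mu w f <= a%:E)%E.
Proof.
move=> a0 H; have : (weighted_norm mu w f <= (a ^+ 2)%:E `^ 2^-1)%E.
  apply: gt0_ler_poweR; rewrite ?in_itv/= ?leey ?andbT ?lee_fin ?invr_ge0 ?sqr_ge0//.
  by apply: integral_ge0 => x _; rewrite lee_fin ge0_weighted_integrand.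
by rewrite poweR_EFin powR12_sqrt ?sqr_ge0// sqrtr_sqr ger0_norm.
Qed.

Lemma weighted_norm_ge (f : R -> R) (a : R) : 0 <= a ->
  ((a ^+ 2)%:E <= \int[mu]_x (`|f x| ^+ 2 * w x)%:E)%E ->
  (a%:E <= weighted_norm mu w f)%E.
Proof.
move=> a0 H; have : ((a ^+ 2)%:E `^ 2^-1 <= weighted_norm mu w f)%E.
  apply: gt0_ler_poweR; rewrite ?in_itv/= ?leey ?andbT ?lee_fin ?invr_ge0 ?sqr_ge0//.
  by apply: integral_ge0 => x _; rewrite lee_fin ge0_weighted_integrand.
by rewrite poweR_EFin powR12_sqrt ?sqr_ge0// sqrtr_sqr ger0_norm.
Qed.

Lemma mI_hull_le1 n : mI mu (shell_hull n.+1) <= 1.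
Proof. by rewrite mI_hull ler_pdivrMr ?ltr0n// mul1r ler_nat. Qed.

Lemma mI_hull_ge n : 2^-1 <= mI mu (shell_hull n.+1).
Proof.
rewrite mI_hull ler_pdivlMr ?ltr0n// -[n.+2%:R]natr1 -[n.+1%:R]natr1.
by have : 0 <= n%:R :> R by []; lra.
Qed.

(** With n = 2 ^ e.+1, the part over J_n is at most m / (n+1) ^ 2 times 2 (n+1), hence at most 2,
    and the part over A_n is m, at most 1. The squared norm is thus at most 3, below 2 ^ 2. *)
Lemma weighted_norm_haar_le e :
  (weighted_norm mu w (haar mu (shell_hull (2 ^ e.+1).+1)) <= 2%:E)%E.
Proof.
apply: weighted_norm_le => //; set n := (2 ^ e.+1)%N.
set m := mI mu (shell_hull n.+1).
have m0 : 0 < m by exact: mI_gt0.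
have m1 : m <= 1 by exact: mI_hull_le1.
have s2 : Num.sqrt m ^+ 2 = m by rewrite sqr_sqrtr// ltW.
(* The weighted square of the Haar function, as a function of the shell index: up to [n] on J_n, and
   [n.+1] on A_n. *)
pose h k : R := (if (k <= n)%N then m / n.+1%:R ^+ 2 else m) * shell_value k.
have h0 k : 0 <= h k.
  apply: mulr_ge0; last exact: ltW (shell_value_gt0 k).
  by case: ifP => _; [rewrite divr_ge0 ?sqr_ge0 ?ltW|exact: ltW].
rewrite (_ : \int[mu]_x _ = \int[mu]_(x in dyadic_set R (shell_hull n.+1)) (h (shell x))%:E)%E.
  rewrite integral_shell_hull// lee_fin big_ord_recr /=.
  rewrite {2}/h ltnn shell_value_pow2S mulr1.
  rewrite (eq_bigr (fun k : 'I_n.+1 => m / n.+1%:R ^+ 2 * shell_value k)); last first.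
    by move=> k _; rewrite /h -ltnS ltn_ord.
  rewrite -mulr_sumr.
  have N1 : 1 <= n.+1%:R :> R by rewrite ler1n.
  have N0 : 0 < n.+1%:R :> R by rewrite ltr0n.
  have c0 : 0 <= m / n.+1%:R ^+ 2 by rewrite divr_ge0 ?sqr_ge0 ?ltW.
  have := ler_wpM2l c0 (@sum_shell_value_le R n).
  have -> : m / n.+1%:R ^+ 2 * (2 * n.+1%:R) = 2 * (m / n.+1%:R).
    by field; rewrite gt_eqF.
  have : m / n.+1%:R <= 1 by rewrite ler_pdivrMr// mul1r (le_trans m1).
  move: (_ * \sum_(_ < _) _) (m / _) => u v; lra.
rewrite [RHS]integral_mkcond; apply: eq_integral => x _.
rewrite patchE; case: ifPn => [/set_mem|/negP xI].
  rewrite dyadic_set_children left_child_hull right_child_hull => -[xI|xI].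
    rewrite haar_left ?left_child_hull// dmass_hull /h.
    have -> : (shell x <= n)%N.
      rewrite shell_le; move: xI; rewrite /dyadic_set /= in_itv /= => /andP[_].
      by rewrite opprK add0r mulr1.
    by rewrite -normrX ger0_norm ?sqr_ge0// expr_div_n s2.
  rewrite haar_right ?right_child_hull// dmass_interval /h.
  rewrite (shell_on_interval xI) ltnn divr1 normrN -normrX ger0_norm ?sqr_ge0// s2.
  by rewrite /shell_weight (shell_on_interval xI).
rewrite haar_out; first by rewrite normr0 expr0n mul0r.
by move=> ?; apply: xI; exact: mem_set.
Qed.

(** The heavy shell A_(n-1) alone suffices: it is the right child of J_n, so the square of the
    difference is m(J_n) there, at least 1/2, with mass 1 and weight 1 + 2 ^ e. *)
Lemma weighted_norm_Sh_haar_ge e (a : R) : 0 <= a -> 2 * a ^+ 2 <= 2 ^+ e ->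
  (a%:E <= weighted_norm mu w (haar mu (shell_hull (2 ^ e.+1)%N)
                              \- haar mu (shell_interval (2 ^ e.+1)%N))%R)%E.
Proof.
move=> a0 ae; apply: weighted_norm_ge => //.
have := @shell_value_pow2 R e; set n := (2 ^ e.+1)%N => vn.
(* Exhibits J_n as a hull of positive index, whose right child is A_(n-1). *)
have nE : n = n.-1.+1 by rewrite prednK// expn_gt0.
have mi := measurable_dyadic (R := R) (shell_interval n.-1).
set g := _ \- _.
have mg : measurable_fun [set: measurableTypeR R] g.
  have : g \in Lfun mu 2%:E.
    rewrite /g nE -left_child_hull -right_child_hull.
    by case: (is_Sh_haar mu_gt0 (shell_hull n.-1.+2)).
  by move=> /andP[/set_mem].
apply: (@le_trans _ _ (\int[mu]_(x in dyadic_set R (shell_interval n.-1))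
    (`|g x| ^+ 2 * w x)%:E)%E); last first.
  apply: ge0_subset_integral => //.
  - apply/measurable_EFinP; apply: measurable_funM; last exact: measurable_comp_shell.
    by apply: measurable_funX; apply: measurableT_comp.
  - by move=> x _; rewrite lee_fin ge0_weighted_integrand.
rewrite (eq_integral (cst (mI mu (shell_hull n) * shell_value n)%:E)); last first.
  move=> x /set_mem xI /=; congr EFin.
  rewrite /shell_weight (shell_on_interval xI) -nE; congr (_ * _).
  (* The Haar function of A_n vanishes here: A_n is the shell [n.+1], while [x] is in shell [n]. *)
  rewrite /g /= [X in _ - X]haar_out; last first.
    by move=> /shell_on_interval; rewrite (shell_on_interval xI) -nE; lia.
  rewrite subr0 [in LHS]nE haar_right ?right_child_hull// -nE dmass_interval.
  by rewrite divr1 normrN -normrX ger0_norm ?sqr_ge0// sqr_sqrtr// ltW// mI_gt0.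
rewrite integral_cst// [X in (_ * X)%E]shell_measure_interval mule1 lee_fin vn.
have := mI_hull_ge n.-1; rewrite -nE => mn.
have : 2^-1 * (1 + 2 ^+ e) <= mI mu (shell_hull n) * (1 + 2 ^+ e).
  by rewrite ler_wpM2r// addr_ge0// exprn_ge0.
lra.
Qed.

Lemma not_Sh_bounded_shell : ~ Sh_bounded mu w.
Proof.
move=> [C CP].
(* Strictly above the largest value that [C] allows for the image of a function of norm at most 2;
   the absolute value covers a negative [C]. *)
pose a : R := 2 * `|C| + 1.
have a0 : 0 <= a by rewrite addr_ge0// mulr_ge0.
pose e := Num.bound (2 * a ^+ 2).
have ae : 2 * a ^+ 2 <= 2 ^+ e by rewrite ltW// upper_nthrootP.
have := is_Sh_haar mu_gt0 (shell_hull (2 ^ e.+1).+1).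
rewrite left_child_hull right_child_hull => Shf.
have f2 := weighted_norm_haar_le e.
have := CP _ _ (haar_Lfun2 mu_gt0 _) (le_lt_trans f2 (ltry _)) Shf.
apply/negP; rewrite -ltNge.
apply: lt_le_trans (weighted_norm_Sh_haar_ge a0 ae).
set N := weighted_norm _ _ _ in f2 *.
have N0 : (0 <= N)%E by exact: poweR_ge0.
apply: (@le_lt_trans _ _ (`|C|%:E * N)%E).
  by rewrite lee_wpmul2r// lee_fin ler_norm.
apply: (@le_lt_trans _ _ (`|C|%:E * 2%:E)%E); first by rewrite lee_wpmul2l// lee_fin.
by rewrite -EFinM lte_fin /a mulrC ltrDl.
Qed.

End shell_unbounded.

Theorem proposition1p3 (R : realType) :
  exists (mu : {measure set (measurableTypeR R) -> \bar R}) (w : R -> R),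
    [/\ balanced mu, A2 mu w & ~ Sh_bounded mu w].
Proof.
exists shell_measure, shell_weight; split.
- exact: shell_measure_balanced.
- exact: A2_shell_weight.
- exact: not_Sh_bounded_shell.
Qed.
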